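(* Let $K$ be a field, let $(H,\cdot,1,\triangle,\epsilon,S)$ be a Hopf algebra over $K$, let $(B,\pi)$ be a quantum subgroup of $H$, and let $(L,\eta)$ be a left $B$-module, where $L$ is a Hilbert space over $K$. Let $L'\subseteq H\otimes L$ be the space of the induced representation (defined in the context). Then $(L',\alpha,\beta,\phi_H)$ is a left Hopf representation of the first type of $H$, where $$\alpha: H\otimes L'\to L',\qquad \alpha(h\otimes h'\otimes l)=h'\otimes \eta(\pi(h)\otimes l),$$ $$\beta: L'\to H\otimes L',\qquad \beta(h\otimes l)=\triangle(h)\otimes l,$$ $$\phi_H: H\otimes H\otimes L'\to H\otimes L',\qquad \phi_H(h\otimes h'\otimes h''\otimes l)=h'\otimes h''\otimes\eta(\pi(h)\otimes l)$$ (all maps extended linearly).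
   Context: All tensor products are algebraic tensor products over $K$. Since $L$ is a Hilbert space over $K$, it is understood that $K$ is $\mathbb{R}$ or $\mathbb{C}$. Quantum subgroup: a pair $(B,\pi)$, where $(B,\cdot_B,1,\triangle_B,\epsilon_B)$ is a bialgebra over $K$ and $\pi:H\to B$ is a bialgebra epimorphism, i.e. a surjective algebra homomorphism with $\epsilon_B\circ\pi=\epsilon$ and $\triangle_B\circ\pi=(\pi\otimes\pi)\circ\triangle$. Left $B$-module $(L,\eta)$: the action is the linear map $\eta:B\otimes L\to L$, satisfying the usual unit and associativity axioms. Left $H$-modules $(W,\alpha)$, with $\alpha:H\otimes W\to W$, are defined in the same way. A left $H$-comodule $(W,\beta)$ has coaction $\beta:W\to H\otimes W$ satisfying the usual axioms $(\epsilon\otimes \mathrm{id}_W)\circ\beta=\mathrm{id}_W$ (identifying $K\otimes W=W$) and $(\triangle\otimes \mathrm{id}_W)\circ\beta=(\mathrm{id}_H\otimes\beta)\circ\beta$. Space of the induced representation: put $R=(\mathrm{id}_H\otimes\pi)\circ\triangle:H\to H\otimes B$. Then $L'$ is the linear subspace of $H\otimes L$ given by $$L'=\{h\otimes l:\ R(h)\otimes\eta(b\otimes l)=h\otimes 1\otimes\eta(b\otimes l)\ \text{ in } H\otimes B\otimes L,\ \text{ for all } b\in B\},$$ where $h\otimes l$ stands for a general element $\sum_i h_i\otimes l_i$ of $H\otimes L$, the condition being extended linearly. Left Hopf representation of the first type: a quadruple $(W,\alpha,\beta,\phi)$ such that (a) $(W,\alpha)$ is a left $H$-module; (b) $(W,\beta)$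 is a left $H$-comodule; (c) $\phi:H\otimes(H\otimes W)\to H\otimes W$ makes $(H\otimes W,\phi)$ a left $H$-module, and $\beta$ is an $H$-module morphism with respect to $\alpha$ and $\phi$, i.e. $\beta\circ\alpha=\phi\circ(\mathrm{id}_H\otimes\beta)$. *)

(* Defs.v *)
From HB Require Import structures.
From mathcomp Require Import all_boot all_order all_algebra.
From mathcomp Require Import complex.
From mathcomp Require Import boolp reals topology normedtype.

Set Implicit Arguments.
Unset Strict Implicit.
Unset Printing Implicit Defensive.

Import GRing.Theory Num.Theory.
Import numFieldNormedType.Exports.

Local Open Scope quotient_scope.
Local Open Scope ring_scope.

Reserved Notation "U ⊗ V" (at level 40, left associativity).
Reserved Notation "u ⊗ₜ v" (at level 40, left associativity).

(* The algebraic tensor product of two K-vector spaces: formal finite sums of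
   pairs, modulo the congruence generated by bilinearity.  A list of pairs
   [:: (u1, v1); ...; (un, vn)] stands for u1 ⊗ v1 + ... + un ⊗ vn; no
   coefficients are needed since a (u ⊗ v) = (a u) ⊗ v.  That this is the
   tensor product (universal property) is [tlift_pure] together with
   [tensor_linear_ext]. *)
Section TensorProduct.
Variables (K : fieldType) (U V : lmodType K).

Inductive tensor_eq : seq (U * V) -> seq (U * V) -> Prop :=
| teq_refl s : tensor_eq s s
| teq_sym s t : tensor_eq s t -> tensor_eq t s
| teq_trans s t r : tensor_eq s t -> tensor_eq t r -> tensor_eq s r
| teq_cat s s' t t' :
    tensor_eq s s' -> tensor_eq t t' -> tensor_eq (s ++ t) (s' ++ t')
| teq_catC s t : tensor_eq (s ++ t) (t ++ s)
| teq_zero v : tensor_eq [:: (0, v)] [::]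
| teq_addl u u' v : tensor_eq [:: (u + u', v)] [:: (u, v); (u', v)]
| teq_addr u v v' : tensor_eq [:: (u, v + v')] [:: (u, v); (u, v')]
| teq_scale a u v : tensor_eq [:: (a *: u, v)] [:: (u, a *: v)].

Definition tensor_eqb (s t : seq (U * V)) : bool := `[< tensor_eq s t >].

Lemma tensor_eqb_refl : reflexive tensor_eqb.
Proof. by move=> s; apply/asboolP; apply: teq_refl. Qed.

Lemma tensor_eqb_sym : symmetric tensor_eqb.
Proof.
by move=> s t; apply/idP/idP => /asboolP st; apply/asboolP; apply: teq_sym.
Qed.

Lemma tensor_eqb_trans : transitive tensor_eqb.
Proof.
move=> t s r /asboolP st /asboolP tr; apply/asboolP.
exact: teq_trans st tr.
Qed.

Canonical tensor_equiv : equiv_rel (seq (U * V)) :=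
  EquivRel tensor_eqb tensor_eqb_refl tensor_eqb_sym tensor_eqb_trans.

Definition tensor := {eq_quot tensor_equiv}.
HB.instance Definition _ := EqQuotient.on tensor.
HB.instance Definition _ := Choice.on tensor.

Lemma tensor_piP (s t : seq (U * V)) :
  reflect (tensor_eq s t) (\pi_tensor s == \pi_tensor t).
Proof. by rewrite eqmodE /=; apply: asboolP. Qed.

Lemma repr_pi (s : seq (U * V)) : tensor_eq (repr (\pi_tensor s)) s.
Proof. by apply/tensor_piP; rewrite reprK. Qed.

Definition tensor_zero : tensor := \pi_tensor [::].
Definition tensor_add (x y : tensor) : tensor := \pi_tensor (repr x ++ repr y).
Definition scale_terms (a : K) (s : seq (U * V)) :=
  [seq (a *: p.1, p.2) | p <- s].
Definition tensor_scale (a : K) (x : tensor) : tensor :=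
  \pi_tensor (scale_terms a (repr x)).
Definition tensor_opp (x : tensor) : tensor := tensor_scale (-1) x.

Lemma tensor_add_pi s t :
  tensor_add (\pi_tensor s) (\pi_tensor t) = \pi_tensor (s ++ t) :> tensor.
Proof. by apply/eqP/tensor_piP/teq_cat; apply: repr_pi. Qed.

Lemma teq_scale_terms a s t :
  tensor_eq s t -> tensor_eq (scale_terms a s) (scale_terms a t).
Proof.
elim=> {s t} /=.
- by move=> s; apply: teq_refl.
- by move=> s t _ IH; apply: teq_sym.
- by move=> s t r _ IH1 _ IH2; apply: teq_trans IH1 IH2.
- by move=> s s' t t' _ IH1 _ IH2; rewrite /scale_terms !map_cat; apply: teq_cat.
- by move=> s t; rewrite /scale_terms !map_cat; apply: teq_catC.
- by move=> v; rewrite /= scaler0; apply: teq_zero.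
- by move=> u u' v; rewrite /= scalerDr; apply: teq_addl.
- by move=> u v v'; apply: teq_addr.
- by move=> b u v; rewrite /= scalerA mulrC -scalerA; apply: teq_scale.
Qed.

Lemma tensor_scale_pi a s :
  tensor_scale a (\pi_tensor s) = \pi_tensor (scale_terms a s) :> tensor.
Proof. by apply/eqP/tensor_piP/teq_scale_terms/repr_pi. Qed.

Lemma tensor_addA : associative tensor_add.
Proof.
elim/quotW=> s; elim/quotW=> t; elim/quotW=> r.
by rewrite (tensor_add_pi t r) (tensor_add_pi s t) !tensor_add_pi catA.
Qed.

Lemma tensor_addC : commutative tensor_add.
Proof.
elim/quotW=> s; elim/quotW=> t.
by rewrite !tensor_add_pi; apply/eqP/tensor_piP/teq_catC.
Qed.

Lemma tensor_add0 : left_id tensor_zero tensor_add.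
Proof. by elim/quotW=> s; rewrite tensor_add_pi. Qed.

Lemma teq_scaleDl a b s :
  tensor_eq (scale_terms (a + b) s) (scale_terms a s ++ scale_terms b s).
Proof.
elim: s => [|[u v] s IH] /=; first exact: teq_refl.
rewrite scalerDl -cat1s.
apply: (teq_trans (t := [:: (a *: u, v); (b *: u, v)] ++
                     (scale_terms a s ++ scale_terms b s))).
  by apply: teq_cat IH; apply: teq_addl.
rewrite -[(a *: u, v) :: (scale_terms a s ++ _)]cat1s.
rewrite -[[:: (a *: u, v); _]]cat1s -catA; apply: teq_cat (teq_refl _) _.
rewrite -[(b *: u, v) :: scale_terms b s]cat1s !catA.
by apply: teq_cat (teq_refl _); apply: teq_catC.
Qed.

Lemma teq_scale0 s : tensor_eq (scale_terms 0 s) [::].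
Proof.
elim: s => [|[u v] s IH] /=; first exact: teq_refl.
rewrite scale0r -cat1s -[[::]]/([::] ++ [::]).
by apply: teq_cat IH; apply: teq_zero.
Qed.

Lemma scale_terms1 s : scale_terms 1 s = s.
Proof. by rewrite -[RHS]map_id; apply: eq_map => -[u v]; rewrite /= scale1r. Qed.

Lemma tensor_addN : left_inverse tensor_zero tensor_opp tensor_add.
Proof.
elim/quotW=> s; rewrite /tensor_opp tensor_scale_pi tensor_add_pi.
apply/eqP/tensor_piP; rewrite -[X in _ ++ X]scale_terms1.
apply: teq_trans (teq_sym (teq_scaleDl _ _ _)) _.
by rewrite addNr; apply: teq_scale0.
Qed.

HB.instance Definition _ :=
  GRing.isZmodule.Build tensor tensor_addA tensor_addC tensor_add0 tensor_addN.

Lemma pi_addE s t : \pi_tensor s + \pi_tensor t = \pi_tensor (s ++ t).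
Proof. exact: tensor_add_pi. Qed.

Lemma tensor_scaleA a b (x : tensor) :
  tensor_scale a (tensor_scale b x) = tensor_scale (a * b) x.
Proof.
elim/quotW: x => s; rewrite (tensor_scale_pi b s) !tensor_scale_pi.
congr (\pi_tensor _).
by rewrite /scale_terms -map_comp; apply: eq_map => -[u v]; rewrite /= scalerA.
Qed.

Lemma tensor_scale1 : left_id 1 tensor_scale.
Proof. by elim/quotW=> s; rewrite tensor_scale_pi scale_terms1. Qed.

Lemma tensor_scaleDr : right_distributive tensor_scale +%R.
Proof.
move=> a; elim/quotW=> s; elim/quotW=> t.
by rewrite pi_addE !tensor_scale_pi pi_addE /scale_terms map_cat.
Qed.

Lemma tensor_scaleDl (x : tensor) :
  {morph tensor_scale^~ x : a b / a + b}.
Proof.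
elim/quotW: x => s a b; rewrite !tensor_scale_pi pi_addE.
exact/eqP/tensor_piP/teq_scaleDl.
Qed.

HB.instance Definition _ := GRing.Zmodule_isLmodule.Build K tensor
  tensor_scaleA tensor_scale1 tensor_scaleDr tensor_scaleDl.

Lemma pi_scaleE a s : a *: \pi_tensor s = \pi_tensor (scale_terms a s).
Proof. exact: tensor_scale_pi. Qed.

Definition pure (u : U) (v : V) : tensor := \pi_tensor [:: (u, v)].

Lemma pure_bilinear : bilinear_for *:%R *:%R pure.
Proof.
split=> [v a u u'|u a v v'].
- rewrite /= /pure pi_scaleE pi_addE.
  exact/eqP/tensor_piP/teq_addl.
- rewrite /= /pure pi_scaleE pi_addE.
  apply/eqP/tensor_piP.
  apply: teq_trans (teq_addr _ _ _) _.
  rewrite -cat1s; apply: teq_cat (teq_refl _).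
  exact/teq_sym/teq_scale.
Qed.

HB.instance Definition _ :=
  bilinear_isBilinear.Build K U V tensor *:%R *:%R pure pure_bilinear.

Lemma tensor_pi_sum s : \pi_tensor s = \sum_(p <- s) pure p.1 p.2.
Proof.
elim: s => [|[u v] s IH]; first by rewrite big_nil.
by rewrite big_cons -IH /pure pi_addE.
Qed.

Lemma tensor_sumP (x : tensor) :
  exists s : seq (U * V), x = \sum_(p <- s) pure p.1 p.2.
Proof. by elim/quotW: x => s; exists s; apply: tensor_pi_sum. Qed.

Lemma tensor_linear_ext (W : lmodType K) (f g : {linear tensor -> W}) :
  (forall u v, f (pure u v) = g (pure u v)) -> f =1 g.
Proof.
move=> fg x; have [s ->] := tensor_sumP x.
by rewrite !linear_sum; apply: eq_bigr => p _; apply: fg.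
Qed.

End TensorProduct.

Notation "U ⊗ V" := (tensor U V) : type_scope.
Notation "U ⊗ V" := (tensor U V) : ring_scope.
Notation "u ⊗ₜ v" := (pure u v) : ring_scope.

(* Linear extension to U ⊗ V of a bilinear map f. *)
Section Lift.
Variables (K : fieldType) (U V W : lmodType K) (f : {bilinear U -> V -> W}).

Definition tlift (x : U ⊗ V) : W := \sum_(p <- repr x) f p.1 p.2.

Lemma teq_lift s t : tensor_eq s t ->
  \sum_(p <- s) f p.1 p.2 = \sum_(p <- t) f p.1 p.2.
Proof.
elim=> {s t}.
- by [].
- by move=> s t _ ->.
- by move=> s t r _ -> _ ->.
- by move=> s s' t t' _ IH1 _ IH2; rewrite !big_cat /= IH1 IH2.
- by move=> s t; rewrite !big_cat /= addrC.
- by move=> v; rewrite big_seq1 big_nil /= linear0l.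
- by move=> u u' v; rewrite !(big_cons, big_nil) /= !addr0 linearDl.
- by move=> u v v'; rewrite !(big_cons, big_nil) /= !addr0 linearDr.
- by move=> a u v; rewrite !big_seq1 /= linearZl_LR linearZr_LR.
Qed.

Lemma tlift_pi s : tlift (\pi_(U ⊗ V) s) = \sum_(p <- s) f p.1 p.2.
Proof. exact/teq_lift/repr_pi. Qed.

Lemma tlift_linear : linear tlift.
Proof.
move=> a; elim/quotW=> s; elim/quotW=> t.
rewrite pi_scaleE pi_addE !tlift_pi big_cat /=; congr (_ + _).
by rewrite big_map scaler_sumr; apply: eq_bigr => p _; rewrite linearZl_LR.
Qed.

HB.instance Definition _ :=
  GRing.isLinear.Build K (U ⊗ V) W *:%R tlift tlift_linear.

Lemma tlift_pure u v : tlift (u ⊗ₜ v) = f u v.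
Proof. by rewrite tlift_pi big_seq1. Qed.

Lemma tlift_sum s :
  tlift (\sum_(p <- s) p.1 ⊗ₜ p.2) = \sum_(p <- s) f p.1 p.2.
Proof. by rewrite -tensor_pi_sum tlift_pi. Qed.

End Lift.


Section TensorMap.
Variables (K : fieldType) (U U' V V' : lmodType K).
Variables (f : {linear U -> U'}) (g : {linear V -> V'}).

Definition tmap_fun (u : U) (v : V) : U' ⊗ V' := f u ⊗ₜ g v.

Lemma tmap_fun_bilinear : bilinear_for *:%R *:%R tmap_fun.
Proof.
split=> [v a u u'|u a v v'] /=; rewrite /tmap_fun linearP.
- by rewrite linearDl linearZl_LR.
- by rewrite linearDr linearZr_LR.
Qed.

HB.instance Definition _ := bilinear_isBilinear.Build K U V (U' ⊗ V')
  *:%R *:%R tmap_fun tmap_fun_bilinear.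

Definition tmap : {linear U ⊗ V -> U' ⊗ V'} := tlift tmap_fun.

Lemma tmap_pure u v : tmap (u ⊗ₜ v) = f u ⊗ₜ g v.
Proof. exact: tlift_pure. Qed.

End TensorMap.

(* The canonical isomorphism (U ⊗ V) ⊗ W -> U ⊗ (V ⊗ W). *)
Section TensorAssoc.
Variables (K : fieldType) (U V W : lmodType K).

Definition tassoc_pure (w : W) (u : U) (v : V) : U ⊗ (V ⊗ W) := u ⊗ₜ (v ⊗ₜ w).

Lemma tassoc_pure_bilinear w : bilinear_for *:%R *:%R (tassoc_pure w).
Proof.
split=> [v a u u'|u a v v'] /=; rewrite /tassoc_pure.
- by rewrite linearDl linearZl_LR.
- by rewrite linearDl linearZl_LR linearDr linearZr_LR.
Qed.

HB.instance Definition _ w := bilinear_isBilinear.Build K U V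
  (U ⊗ (V ⊗ W)) *:%R *:%R (tassoc_pure w) (tassoc_pure_bilinear w).

Definition tassoc_fun (x : U ⊗ V) (w : W) : U ⊗ (V ⊗ W) :=
  tlift (tassoc_pure w) x.

Lemma tassoc_fun_bilinear : bilinear_for *:%R *:%R tassoc_fun.
Proof.
split=> [w a x y|x a w w'] /=; rewrite /tassoc_fun; first exact: linearP.
have [s ->] := tensor_sumP x.
rewrite !tlift_sum scaler_sumr -big_split; apply: eq_bigr => p _ /=.
by rewrite /tassoc_pure !linearDr !linearZr_LR.
Qed.

HB.instance Definition _ := bilinear_isBilinear.Build K (U ⊗ V) W
  (U ⊗ (V ⊗ W)) *:%R *:%R tassoc_fun tassoc_fun_bilinear.

Definition tassoc : {linear (U ⊗ V) ⊗ W -> U ⊗ (V ⊗ W)} := tlift tassoc_fun.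

Lemma tassoc_pureE u v w : tassoc (u ⊗ₜ v ⊗ₜ w) = u ⊗ₜ (v ⊗ₜ w).
Proof. by apply: etrans (tlift_pure _ _ _) _; apply: tlift_pure. Qed.

End TensorAssoc.

Arguments tassoc {K U V W}.

(* The identifications K ⊗ W = W and W ⊗ K = W. *)
Section TensorUnit.
Variables (K : fieldType) (W : lmodType K).

Definition tunitl_fun (k : K^o) (w : W) : W := (k : K) *: w.
Definition tunitr_fun (w : W) (k : K^o) : W := (k : K) *: w.

Lemma tunitl_fun_bilinear : bilinear_for *:%R *:%R tunitl_fun.
Proof.
split=> [w a k k'|k a w w'] /=; rewrite /tunitl_fun.
- by rewrite scalerDl scalerA.
- by rewrite scalerDr !scalerA mulrC.
Qed.

Lemma tunitr_fun_bilinear : bilinear_for *:%R *:%R tunitr_fun.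
Proof. by split=> [w a k k'|k a w w'] /=; apply tunitl_fun_bilinear. Qed.

HB.instance Definition _ := bilinear_isBilinear.Build K K^o W W
  *:%R *:%R tunitl_fun tunitl_fun_bilinear.
HB.instance Definition _ := bilinear_isBilinear.Build K W K^o W
  *:%R *:%R tunitr_fun tunitr_fun_bilinear.

Definition tunitl : {linear K^o ⊗ W -> W} := tlift tunitl_fun.
Definition tunitr : {linear W ⊗ K^o -> W} := tlift tunitr_fun.

Lemma tunitl_pure k w : tunitl (k ⊗ₜ w) = k *: w.
Proof. exact: tlift_pure. Qed.

Lemma tunitr_pure w k : tunitr (w ⊗ₜ k) = k *: w.
Proof. exact: tlift_pure. Qed.

End TensorUnit.

Arguments tunitl {K W}.
Arguments tunitr {K W}.

Section TensorAlgebra.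
Variables (K : fieldType) (A : algType K).

Definition mul_fun (a b : A) : A := a * b.

Lemma mul_fun_bilinear : bilinear_for *:%R *:%R mul_fun.
Proof.
split=> [b a x y|x a b c] /=; rewrite /mul_fun.
- by rewrite mulrDl scalerAl.
- by rewrite mulrDr scalerAr.
Qed.

HB.instance Definition _ := bilinear_isBilinear.Build K A A A
  *:%R *:%R mul_fun mul_fun_bilinear.

Definition mul_bil : {bilinear A -> A -> A} := mul_fun.

Definition tensor_mult : {linear A ⊗ A -> A} := tlift mul_bil.

Lemma tensor_mult_pure a b : tensor_mult (a ⊗ₜ b) = a * b.
Proof. exact: tlift_pure. Qed.

(* The product (a ⊗ₜ b) (c ⊗ₜ d) = ac ⊗ₜ bd of the algebra A ⊗ A. *)
Definition tensor_mul_pure (y : A ⊗ A) (a b : A) : A ⊗ A :=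
  tmap (mul_bil a) (mul_bil b) y.

Lemma tensor_mul_pure_bilinear y : bilinear_for *:%R *:%R (tensor_mul_pure y).
Proof.
have [s ->] := tensor_sumP y.
split=> [b a x z|x a b z] /=; rewrite /tensor_mul_pure.
- rewrite /tmap /= !tlift_sum scaler_sumr -big_split.
  apply: eq_bigr => p _ /=; rewrite /tmap_fun /=.
  by rewrite /mul_fun mulrDl -scalerAl linearDl linearZl_LR.
- rewrite /tmap /= !tlift_sum scaler_sumr -big_split.
  apply: eq_bigr => p _ /=; rewrite /tmap_fun /=.
  by rewrite /mul_fun mulrDl -scalerAl linearDr linearZr_LR.
Qed.

HB.instance Definition _ y := bilinear_isBilinear.Build K A A (A ⊗ A)
  *:%R *:%R (tensor_mul_pure y) (tensor_mul_pure_bilinear y).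

Definition tensor_mul (x y : A ⊗ A) : A ⊗ A := tlift (tensor_mul_pure y) x.

Lemma tensor_mulE a b c d :
  tensor_mul (a ⊗ₜ b) (c ⊗ₜ d) = (a * c) ⊗ₜ (b * d).
Proof. by apply: etrans (tlift_pure _ _ _) _; apply: tmap_pure. Qed.

End TensorAlgebra.

Arguments tensor_mult {K A}.

Section Bialgebra.
Variables (K : fieldType) (H : algType K).
Variables (Delta : {linear H -> H ⊗ H}) (eps : {linear H -> K^o}).

Record is_bialgebra : Prop := IsBialgebra {
  comul_coassoc : forall h,
    tassoc (tmap Delta idfun (Delta h)) = tmap idfun Delta (Delta h);
  comul_counitl : forall h, tunitl (tmap eps idfun (Delta h)) = h;
  comul_counitr : forall h, tunitr (tmap idfun eps (Delta h)) = h;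
  comul1 : Delta 1 = 1 ⊗ₜ 1;
  comulM : forall h k, Delta (h * k) = tensor_mul (Delta h) (Delta k);
  counit1 : eps 1 = 1;
  counitM : forall h k, eps (h * k) = eps h * eps k }.

Record is_hopf_algebra (S : {linear H -> H}) : Prop := IsHopfAlgebra {
  hopf_bialgebra : is_bialgebra;
  antipodel : forall h, tensor_mult (tmap S idfun (Delta h)) = (eps h)%:A;
  antipoder : forall h, tensor_mult (tmap idfun S (Delta h)) = (eps h)%:A }.

End Bialgebra.

Record is_quantum_subgroup (K : fieldType) (H B : algType K)
    (Delta : {linear H -> H ⊗ H}) (eps : {linear H -> K^o})
    (DeltaB : {linear B -> B ⊗ B}) (epsB : {linear B -> K^o})
    (pi : {lrmorphism H -> B}) : Prop := IsQuantumSubgroup {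
  qsub_bialgebra : is_bialgebra DeltaB epsB;
  qsub_surj : forall b, exists h, pi h = b;
  qsub_counit : forall h, epsB (pi h) = eps h;
  qsub_comul : forall h, DeltaB (pi h) = tmap pi pi (Delta h) }.

Record is_left_module (K : fieldType) (A : algType K) (W : lmodType K)
    (act : {linear A ⊗ W -> W}) : Prop := IsLeftModule {
  lmod_act1 : forall w, act (1 ⊗ₜ w) = w;
  lmod_actM : forall a b w, act ((a * b) ⊗ₜ w) = act (a ⊗ₜ act (b ⊗ₜ w)) }.

Record is_left_comodule (K : fieldType) (H : algType K)
    (Delta : {linear H -> H ⊗ H}) (eps : {linear H -> K^o})
    (W : lmodType K) (coact : {linear W -> H ⊗ W}) : Prop := IsLeftComodule {
  lcomod_counit : forall w, tunitl (tmap eps idfun (coact w)) = w;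
  lcomod_coassoc : forall w,
    tassoc (tmap Delta idfun (coact w)) = tmap idfun coact (coact w) }.

Record is_left_hopf_rep1 (K : fieldType) (H : algType K)
    (Delta : {linear H -> H ⊗ H}) (eps : {linear H -> K^o}) (W : lmodType K)
    (alpha : {linear H ⊗ W -> W}) (beta : {linear W -> H ⊗ W})
    (phi : {linear H ⊗ (H ⊗ W) -> H ⊗ W}) : Prop := IsLeftHopfRep1 {
  hopf_rep_module : is_left_module alpha;
  hopf_rep_comodule : is_left_comodule Delta eps beta;
  hopf_rep_phi_module : is_left_module phi;
  hopf_rep_morph : forall x, beta (alpha x) = phi (tmap idfun beta x) }.

Section InducedSpace.
Variables (K : fieldType) (H B : algType K) (Delta : {linear H -> H ⊗ H}).
Variables (pi : {lrmorphism H -> B}) (L : lmodType K).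
Variable eta : {linear B ⊗ L -> L}.

(* R = (id ⊗ π) ∘ Δ, and h |-> h ⊗ 1; the condition defining L' is an equality
   in (H ⊗ B) ⊗ L. *)
Definition coactR : {linear H -> H ⊗ B} := tmap idfun pi \o Delta.

Definition tensor1 : {linear H -> H ⊗ B} := applyr (@pure K H B) 1.

Definition actB (b : B) : {linear L -> L} := eta \o (@pure K B L : {bilinear B -> L -> B ⊗ L}) b.

Definition induced_pred : {pred H ⊗ L} := fun x =>
  `[< forall b, tmap coactR (actB b) x = tmap tensor1 (actB b) x >].

Lemma induced_pred_subsemimod : subsemimod_closed induced_pred.
Proof.
split; first split.
- by apply/asboolP => b; rewrite !linear0.
- move=> x y /asboolP xP /asboolP yP; apply/asboolP => b.
  by rewrite !linearD xP yP.
- by move=> a x /asboolP xP; apply/asboolP => b; rewrite !linearZ_LR xP.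
Qed.

Record induced_space := InducedSpace {
  induced_val : H ⊗ L;
  induced_valP : induced_val \in induced_pred }.

HB.instance Definition _ := [isSub for induced_val].
HB.instance Definition _ := [Choice of induced_space by <:].
HB.instance Definition _ := GRing.SubChoice_isSubLmodule.Build K (H ⊗ L)
  induced_pred induced_space induced_pred_subsemimod.

Definition induced_incl : {linear induced_space -> H ⊗ L} := \val.

(* The formulas for the structure maps, read in H ⊗ L and, for the maps with
   values in H ⊗ L', in H ⊗ (H ⊗ L) through id ⊗ incl.  The latter is injective
   because K is a field, so that each formula determines the linear map; that a
   map into L' or H ⊗ L' satisfying it exists is a claim, not a convention. *)
Definition is_induced_action
    (alpha : {linear H ⊗ induced_space -> induced_space}) : Prop :=
  forall h x,
    induced_incl (alpha (h ⊗ₜ x)) = tmap idfun (actB (pi h)) (induced_incl x).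

Definition is_induced_coaction
    (beta : {linear induced_space -> H ⊗ induced_space}) : Prop :=
  forall x, tmap idfun induced_incl (beta x)
            = tassoc (tmap Delta idfun (induced_incl x)).

Definition is_induced_phi (phi : {linear H ⊗ (H ⊗ induced_space)
                                  -> H ⊗ induced_space}) : Prop :=
  forall h h' x, tmap idfun induced_incl (phi (h ⊗ₜ (h' ⊗ₜ x)))
                 = h' ⊗ₜ tmap idfun (actB (pi h)) (induced_incl x).

End InducedSpace.

Variant real_or_complex (R : realType) : numFieldType -> Type :=
| RealScalars : real_or_complex R R
| ComplexScalars : real_or_complex R R[i].

Definition scalar_conj (R : realType) (K : numFieldType)
    (KRC : real_or_complex R K) : K -> K :=
  match KRC in real_or_complex _ K' return K' -> K' with
  | RealScalars => id
  | ComplexScalars => @conjc R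
  end.

(* Main.v *)
Require Import Defs.
From HB Require Import structures.
From mathcomp Require Import all_boot all_order all_algebra.
From mathcomp Require Import complex.
From mathcomp Require Import boolp classical_sets reals topology normedtype.

Set Implicit Arguments.
Unset Strict Implicit.
Unset Printing Implicit Defensive.

Import GRing.Theory Num.Theory.
Import numFieldNormedType.Exports.

Local Open Scope ring_scope.

(** In Sweedler notation the coaction on L' is h ⊗ l |-> h_1 ⊗ (h_2 ⊗ l), the
    restriction to L' of the cofree coaction D = assoc o (Delta ⊗ id) of
    H ⊗ L; the action and phi_H touch only the last tensor factor.  So every
    axiom holds because it holds on H ⊗ L and passes to a subspace, and the
    substance of the theorem is that the maps do restrict.

    Let F = R ⊗ id - (. ⊗ 1) ⊗ id, a map H ⊗ L -> (H ⊗ B) ⊗ L.  Since eta is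
    unital, the case b = 1 of the condition defining L' implies all the others,
    and L' = ker F ([induced_predP]).  Operators on the factor L commute with F,
    hence preserve L' ([induced_act_stable]).

    For the coaction, both R and h |-> h ⊗ 1 are morphisms of left
    H-comodules from H to the cofree comodule H ⊗ B ([coactR_colinear], by
    coassociativity, and [tensor1_colinear]).  Therefore (id ⊗ F) o D factors
    through F, and D maps L' into ker (id ⊗ F).  Over a field the functor
    H ⊗ - is exact, so this kernel is H ⊗ ker F = H ⊗ L'
    ([tmap_idl_exact]), which gives the coaction ([induced_coact_stable]).

    Exactness is proved by splitting: Zorn's lemma provides complements of
    subspaces, so that a linear map q vanishing on ker f factors through f
    ([linear_factor]), and factorisations survive tensoring with an identity.
    The same splitting makes id ⊗ incl : H ⊗ L' -> H ⊗ (H ⊗ L) injective, which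
    is what lets identities in H ⊗ L' be verified in H ⊗ (H ⊗ L). *)

(** * Linear maps over a field split *)

(** The complement is a maximal subspace C meeting X only in 0: if v were not in
    X + C, the span of C and v would still meet X only in 0. *)
Lemma complement_exists (K : fieldType) (V : lmodType K) (X : set V) :
    X 0 -> (forall a x, X x -> X (a *: x)) ->
  exists C : set V,
    [/\ C 0, forall a x y, C x -> C y -> C (a *: x + y),
        forall x, C x -> X x -> x = 0 &
        forall v, exists2 x, X x & C (v - x)].
Proof.
move=> X0 Xscale.
pose indep (C : set V) := (forall a x y, C x -> C y -> C (a *: x + y)) /\
  (forall x, C x -> X x -> x = 0).
have [F FP Ftot|C [[Clin CX] Cmax]] := @Zorn_bigcup V indep.
  split=> [a x y [A FA Ax] [D FD Dy]|x [A FA Ax] Xx].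
    have [AD|DA] := Ftot _ _ FA FD.
      by exists D => //; apply: (FP _ FD).1 => //; apply: AD.
    by exists A => //; apply: (FP _ FA).1 => //; apply: DA.
  exact: (FP _ FA).2 Ax Xx.
have C0 : C 0.
  (* An empty chain has the empty union, so the maximal set could a priori be
     empty; {0} would then be larger. *)
  apply: contrapT => nC0; apply: (Cmax [set 0]%classic).
    split=> [x Cx|/(_ 0 erefl)//]; case: nC0.
    by rewrite -(addNr x) -scaleN1r; apply: Clin.
  by split=> [a x y -> ->|x ->//]; rewrite /= scaler0 addr0.
exists C; split=> // v; apply: contrapT => nv.
apply: (Cmax [set x | exists a, exists2 c, C c & x = a *: v + c]%classic).
  split=> [c Cc|sub]; first by exists 0, c; rewrite ?scale0r ?add0r.
  apply: nv; exists 0; rewrite // subr0; apply: sub.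
  by exists 1, 0; rewrite ?scale1r ?addr0.
split=> [a _ _ [b [c Cc ->]] [b' [c' Cc' ->]]|_ [a [c Cc ->]] Xac].
  exists (a * b + b'), (a *: c + c'); first exact: Clin.
  by rewrite scalerDr scalerA scalerDl addrACA.
have [a0|a0] := eqVneq a 0.
  by move: Xac; rewrite a0 scale0r add0r; apply: CX.
case: nv; exists (a^-1 *: (a *: v + c)); first exact: Xscale.
rewrite scalerDr scalerA mulVf // scale1r opprD addNKr -scaleNr -[_ *: c]addr0.
exact: Clin.
Qed.

(** On w = f u + c, with c in a complement of the range of f, put g w = q u;
    the choice of u is immaterial because q vanishes on ker f. *)
Lemma linear_factor (K : fieldType) (U V W : lmodType K)
    (f : {linear U -> W}) (q : {linear U -> V}) :
    (forall u, f u = 0 -> q u = 0) ->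
  exists g : {linear W -> V}, forall u, g (f u) = q u.
Proof.
move=> fq.
have [|a w [u _ <-]|C [C0 Clin CX Cspan]] := @complement_exists K W (range f).
- by exists 0; rewrite ?linear0.
- by exists (a *: u); rewrite ?linearZ.
have /choice[p pP] w : exists u, C (w - f u).
  by have [_ [u _ <-]] := Cspan w; exists u.
have qp w u : C (w - f u) -> q (p w) = q u.
  move=> Cu; apply/eqP; rewrite -subr_eq0 -linearB; apply/eqP/fq/CX; last first.
    by exists (p w - u).
  have -> : f (p w - u) = -1 *: (w - f (p w)) + (w - f u).
    by rewrite linearB scaleN1r opprB addrA subrK.
  exact: Clin.
have qp_linear : linear (q \o p).
  move=> a w w' /=; rewrite -linearP; apply: qp.
  by rewrite linearP opprD addrACA -scalerBr; apply: Clin.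
pose g : {linear W -> V} :=
  HB.pack (q \o p) (GRing.isLinear.Build K W V *:%R (q \o p) qp_linear).
by exists g => u; apply: qp; rewrite subrr.
Qed.

Lemma linear_retraction (K : fieldType) (U V : lmodType K)
    (i : {linear U -> V}) :
  injective i -> exists r : {linear V -> U}, cancel i r.
Proof.
move=> i_inj; apply: (@linear_factor K U U V i idfun) => u iu0.
by apply: i_inj; rewrite linear0.
Qed.

(** This reduces the existence of the action and of the coaction to a
    computation on one vector at a time. *)
Lemma linear_corestrict (K : fieldType) (X W V : lmodType K)
    (i : {linear W -> V}) (f : {linear X -> V}) :
    injective i -> (forall x, exists w, i w = f x) ->
  exists g : {linear X -> W}, forall x, i (g x) = f x.
Proof.
move=> /linear_retraction[r ir] fi; exists (r \o f) => x /=.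
by have [w <-] := fi x; rewrite ir.
Qed.

(** * Tensor products of linear maps *)

Section TensorMaps.
Variable K : fieldType.

Lemma tensor_ind (U V : lmodType K) (P : U ⊗ V -> Prop) :
    (forall u v, P (u ⊗ₜ v)) -> (forall x y, P x -> P y -> P (x + y)) ->
  forall x, P x.
Proof.
move=> Ppure Padd x; have [s ->] := tensor_sumP x.
apply: (big_ind P) => //.
by rewrite -(linear0r (@pure K U V) 0); apply: Ppure.
Qed.

(** The third pair of maps stands for the composites: it need not be
    syntactically of the form [f \o f'], so that commuting squares can be
    tensored without first rewriting maps under [tmap]. *)
Lemma tmap_tmap (U U' U'' V V' V'' : lmodType K)
    (f : {linear U' -> U''}) (f' : {linear U -> U'}) (f'' : {linear U -> U''})
    (g : {linear V' -> V''}) (g' : {linear V -> V'}) (g'' : {linear V -> V''}) :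
    (forall u, f (f' u) = f'' u) -> (forall v, g (g' v) = g'' v) ->
  forall x, tmap f g (tmap f' g' x) = tmap f'' g'' x.
Proof.
move=> ff gg; elim/tensor_ind => [u v|x y IHx IHy].
  by rewrite !tmap_pure ff gg.
by rewrite !linearD IHx IHy.
Qed.

Lemma tmap_idl_tmap (U V V' V'' : lmodType K)
    (g : {linear V' -> V''}) (g' : {linear V -> V'}) (g'' : {linear V -> V''}) :
    (forall v, g (g' v) = g'' v) ->
  forall x : U ⊗ V, tmap idfun g (tmap idfun g' x) = tmap idfun g'' x.
Proof. exact: (@tmap_tmap U U U _ _ _ idfun idfun idfun). Qed.

Lemma tmap_id (U V : lmodType K) (f : {linear U -> U}) (g : {linear V -> V}) :
  f =1 id -> g =1 id -> forall x, tmap f g x = x.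
Proof.
move=> ff gg; elim/tensor_ind => [u v|x y IHx IHy].
  by rewrite tmap_pure ff gg.
by rewrite linearD IHx IHy.
Qed.

Lemma eq_tmap (U U' V V' : lmodType K) (f f' : {linear U -> U'})
    (g g' : {linear V -> V'}) :
  f =1 f' -> g =1 g' -> tmap f g =1 tmap f' g'.
Proof.
by move=> ff gg; apply: tensor_linear_ext => u v; rewrite !tmap_pure ff gg.
Qed.

Lemma tmap_idl_sub (U V V' : lmodType K) (g g' : {linear V -> V'})
    (x : U ⊗ V) :
  tmap idfun (g \- g') x = tmap idfun g x - tmap idfun g' x.
Proof.
elim/tensor_ind: x => [u v|x y IHx IHy]; first by rewrite !tmap_pure linearBr.
by rewrite !linearD IHx IHy addrACA.
Qed.

(** A retraction of i gives a retraction of id ⊗ i. *)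
Lemma tmap_idl_inj (U V V' : lmodType K) (i : {linear V -> V'}) :
  injective i -> injective (tmap (idfun : {linear U -> U}) i).
Proof.
move=> /linear_retraction[r ir] x y /(congr1 (tmap idfun r)).
by rewrite !(@tmap_idl_tmap _ _ _ _ r i idfun) // !tmap_id.
Qed.

(** With r a retraction of i, the map id - i r vanishes on ker F, which lies
    in the image of i, so it is G F for some G.  Then y - (id ⊗ i r) y is
    (id ⊗ G) (id ⊗ F) y = 0, and y comes from (id ⊗ r) y. *)
Lemma tmap_idl_exact (U V V' W : lmodType K)
    (i : {linear V -> V'}) (F : {linear V' -> W}) :
    injective i -> (forall v, F v = 0 -> exists x, i x = v) ->
  forall y : U ⊗ V', tmap idfun F y = 0 ->
  exists x : U ⊗ V, tmap idfun i x = y.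
Proof.
move=> i_inj iF y Fy0.
have [r ir] := linear_retraction i_inj.
have [v Fv0|G GF] := @linear_factor K V' V' W F (idfun \- (i \o r)).
  by have [x <-] := iF v Fv0; rewrite /= ir subrr.
exists (tmap idfun r y); apply/esym/eqP; rewrite -subr_eq0.
rewrite (tmap_idl_tmap (g'' := i \o r)) //.
rewrite -{1}(@tmap_id U V' idfun idfun _ _ y) // -tmap_idl_sub.
by rewrite -(tmap_idl_tmap GF) Fy0 linear0.
Qed.

Lemma tassoc_tmap (U U' V V' W W' : lmodType K) (f : {linear U -> U'})
    (g : {linear V -> V'}) (h : {linear W -> W'}) x :
  tassoc (tmap (tmap f g) h x) = tmap f (tmap g h) (tassoc x).
Proof.
elim/tensor_ind: x => [x w|x y IHx IHy]; last by rewrite !linearD IHx IHy.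
elim/tensor_ind: x => [u v|x y IHx IHy].
  by rewrite !(tmap_pure, tassoc_pureE).
by rewrite !(linearDl, linearD) IHx IHy.
Qed.

End TensorMaps.

(** * Constructions of modules *)

Section Modules.
Variables (K : fieldType) (A : algType K).

Section RightFactor.
Variables (U M : lmodType K) (act : {linear A ⊗ M -> M}).

(** A acts on U ⊗ M through M alone.  For U = H this is both the action on
    H ⊗ L, with M = L, and phi_H, with M = L'. *)
Definition right_act_fun (a : A) (y : U ⊗ M) : U ⊗ M :=
  tmap idfun (actB act a) y.

Lemma right_act_fun_bilinear : bilinear_for *:%R *:%R right_act_fun.
Proof.
split=> [y a b b'|b a y y']; last exact: linearP.
change (right_act_fun (a *: b + b') y =
        a *: right_act_fun b y + right_act_fun b' y).
rewrite /right_act_fun.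
elim/tensor_ind: y => [u m|y y' IH IH'].
  by rewrite !tmap_pure /= linearPl linearP /= linearPr.
by rewrite !linearD IH IH' addrACA.
Qed.

HB.instance Definition _ := bilinear_isBilinear.Build K A (U ⊗ M) (U ⊗ M)
  *:%R *:%R right_act_fun right_act_fun_bilinear.

Definition right_act : {linear A ⊗ (U ⊗ M) -> U ⊗ M} := tlift right_act_fun.

Lemma right_act_pure a y : right_act (a ⊗ₜ y) = tmap idfun (actB act a) y.
Proof. exact: tlift_pure. Qed.

Lemma right_act_module : is_left_module act -> is_left_module right_act.
Proof.
case=> act1 actM; split=> [y|a b y]; rewrite !right_act_pure.
  by rewrite tmap_id // => m; apply: act1.
by rewrite (tmap_idl_tmap (g'' := actB act (a * b))) // => m; rewrite /= actM.
Qed.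

End RightFactor.

Lemma submodule_act (W V : lmodType K) (i : {linear W -> V})
    (actW : {linear A ⊗ W -> W}) (actV : {linear A ⊗ V -> V}) :
    injective i -> (forall a w, i (actW (a ⊗ₜ w)) = actV (a ⊗ₜ i w)) ->
  is_left_module actV -> is_left_module actW.
Proof.
move=> i_inj iact [act1 actM]; split=> [w|a b w]; apply: i_inj.
  by rewrite iact act1.
by rewrite !iact actM.
Qed.

Lemma pullback_act (B : algType K) (pi : {lrmorphism A -> B}) (M : lmodType K)
    (act : {linear B ⊗ M -> M}) :
  is_left_module act -> is_left_module (act \o tmap pi idfun).
Proof.
case=> act1 actM; split=> [m|a b m] /=; rewrite !tmap_pure.
  by rewrite rmorph1 act1.
by rewrite rmorphM actM.
Qed.

End Modules.

(** * The cofree comodule H ⊗ V *)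

Section CofreeComodule.
Variables (K : fieldType) (H : algType K) (Delta : {linear H -> H ⊗ H}).

Definition cofree_coact (V : lmodType K) : {linear H ⊗ V -> H ⊗ (H ⊗ V)} :=
  tassoc \o tmap Delta idfun.

Lemma cofree_coact_pure (V : lmodType K) h (v : V) :
  cofree_coact V (h ⊗ₜ v) = tassoc (Delta h ⊗ₜ v).
Proof. by rewrite /= tmap_pure. Qed.

Lemma cofree_coact_natural (V V' : lmodType K) (g : {linear V -> V'}) x :
  cofree_coact V' (tmap idfun g x) =
  tmap idfun (tmap idfun g) (cofree_coact V x).
Proof.
rewrite /= -tassoc_tmap; congr (tassoc _).
rewrite (@tmap_tmap _ _ _ _ _ _ _ Delta idfun Delta idfun g g) //.
apply/esym; apply: tmap_tmap => // h; exact: tmap_id.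
Qed.

(** The hypothesis says that f is a comodule morphism from H to H ⊗ V.  Then
    f ⊗ id_L is one from H ⊗ L to (H ⊗ V) ⊗ L, where H coacts on the first
    factor. *)
Lemma cofree_coact_tmap (V L : lmodType K) (f : {linear H -> H ⊗ V}) :
    (forall h, cofree_coact V (f h) = tmap idfun f (Delta h)) ->
  forall x : H ⊗ L, tmap idfun (tmap f idfun) (cofree_coact L x) =
    tassoc (tmap (cofree_coact V) idfun (tmap f idfun x)).
Proof.
move=> f_colin x; rewrite /= -tassoc_tmap; congr (tassoc _).
rewrite (@tmap_tmap _ _ _ _ _ _ _ _ Delta (tmap idfun f \o Delta) _ _ idfun) //.
by apply/esym; apply: tmap_tmap => // h; apply: f_colin.
Qed.

(** These are the counit and coassociativity axioms of H tensored with V, up to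
    moving parentheses. *)
Lemma cofree_comodule (eps : {linear H -> K^o}) (V : lmodType K) :
  is_bialgebra Delta eps -> is_left_comodule Delta eps (cofree_coact V).
Proof.
move=> bialgH; split; elim/tensor_ind => [h v|x y IHx IHy].
- rewrite cofree_coact_pure -{2}(comul_counitl bialgH h).
  elim/tensor_ind: (Delta h) => [a b|x y IHx IHy].
    by rewrite tassoc_pureE !tmap_pure !tunitl_pure linearZl_LR.
  by rewrite !(linearDl, linearD) IHx IHy.
- by rewrite !linearD IHx IHy.
- have pentagon (z : H ⊗ H) (b : H) : tassoc (z ⊗ₜ (b ⊗ₜ v)) =
      tmap idfun tassoc (tassoc (tassoc (z ⊗ₜ b) ⊗ₜ v)).
    elim/tensor_ind: z => [a c|x y IHx IHy].
      by rewrite !(tassoc_pureE, tmap_pure).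
    by rewrite !(linearDl, linearD) IHx IHy.
  transitivity (tmap idfun tassoc (tassoc
     (tassoc (tmap Delta idfun (Delta h)) ⊗ₜ v))).
    rewrite cofree_coact_pure; elim/tensor_ind: (Delta h) => [a b|x y IHx IHy].
      by rewrite tassoc_pureE !tmap_pure -pentagon.
    by rewrite !(linearDl, linearD) IHx IHy.
  rewrite (comul_coassoc bialgH) cofree_coact_pure.
  elim/tensor_ind: (Delta h) => [a b|x y IHx IHy].
    by rewrite !(tassoc_pureE, tmap_pure) cofree_coact_pure.
  by rewrite !(linearDl, linearD) IHx IHy.
- by rewrite !linearD IHx IHy.
Qed.

(** Coassociativity is an identity in H ⊗ (H ⊗ W), checked in H ⊗ (H ⊗ V): this
    is where i has to stay injective after tensoring twice. *)
Lemma subcomodule_coact (eps : {linear H -> K^o}) (W V : lmodType K)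
    (i : {linear W -> V}) (coactW : {linear W -> H ⊗ W})
    (coactV : {linear V -> H ⊗ V}) :
    injective i -> (forall w, tmap idfun i (coactW w) = coactV (i w)) ->
  is_left_comodule Delta eps coactV -> is_left_comodule Delta eps coactW.
Proof.
move=> i_inj icoact [counit coassoc]; split=> w.
  apply: i_inj; rewrite -[RHS]counit -icoact.
  elim/tensor_ind: (coactW w) => [h u|x y IHx IHy].
    by rewrite !tmap_pure !tunitl_pure linearZ_LR.
  by rewrite !linearD IHx IHy.
apply: (tmap_idl_inj (tmap_idl_inj i_inj)).
rewrite -(@cofree_coact_natural W V i) /= icoact coassoc -icoact.
rewrite (tmap_idl_tmap (g'' := coactV \o i)) //.
exact/esym/tmap_idl_tmap.
Qed.

End CofreeComodule.

(** * The induced representation *)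

Section Induced.
Variables (K : fieldType) (H B : algType K) (Delta : {linear H -> H ⊗ H}).
Variables (eps : {linear H -> K^o}) (pi : {lrmorphism H -> B}).
Variables (L : lmodType K) (eta : {linear B ⊗ L -> L}).
Hypotheses (bialgH : is_bialgebra Delta eps) (modL : is_left_module eta).

Local Notation L' := (induced_space Delta pi eta).
Local Notation incl := (induced_incl Delta pi eta).
Local Notation coactR := (coactR Delta pi).
Local Notation tensor1 := (tensor1 H B).

Lemma incl_inj : injective incl.
Proof. exact: val_inj. Qed.

(** The condition for b is the condition for b = 1 followed by id ⊗ eta_b. *)
Lemma induced_predP (x : H ⊗ L) :
  reflect (tmap coactR idfun x = tmap tensor1 idfun x)
          (x \in induced_pred Delta pi eta).
Proof.
have tmap_actB (f : {linear H -> H ⊗ B}) b :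
    tmap f (actB eta b) x = tmap idfun (actB eta b) (tmap f idfun x).
  by apply/esym; apply: tmap_tmap.
apply: (iffP (asboolP _)) => [/(_ 1)|coinv b]; last first.
  by rewrite !tmap_actB coinv.
rewrite !tmap_actB !tmap_id // => l; exact: lmod_act1 modL l.
Qed.

Lemma induced_coinvariant (x : L') :
  tmap coactR idfun (incl x) = tmap tensor1 idfun (incl x).
Proof. exact/induced_predP/induced_valP. Qed.

(** The invariance condition concerns the factor H, the action the factor L. *)
Lemma induced_act_stable h (x : L') :
  exists y : L', incl y = tmap idfun (actB eta (pi h)) (incl x).
Proof.
suff yP : tmap idfun (actB eta (pi h)) (incl x) \in induced_pred Delta pi eta.
  by exists (InducedSpace yP).
have tmapC (f : {linear H -> H ⊗ B}) (g : {linear L -> L}) :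
    tmap f idfun (tmap idfun g (incl x)) = tmap idfun g (tmap f idfun (incl x)).
  rewrite (@tmap_tmap _ _ _ _ _ _ _ f idfun f idfun g g) //.
  by apply/esym; apply: tmap_tmap.
by apply/induced_predP; rewrite !tmapC induced_coinvariant.
Qed.

(** h_1 ⊗ h_2 ⊗ pi h_3, bracketed in two ways. *)
Lemma coactR_colinear h :
  cofree_coact Delta B (coactR h) = tmap idfun coactR (Delta h).
Proof.
rewrite -(@tmap_idl_tmap _ _ _ _ _ (tmap idfun pi) Delta coactR) //.
by rewrite -(comul_coassoc bialgH) cofree_coact_natural.
Qed.

Lemma tensor1_colinear h :
  cofree_coact Delta B (tensor1 h) = tmap idfun tensor1 (Delta h).
Proof.
rewrite cofree_coact_pure.
elim/tensor_ind: (Delta h) => [a b|x y IHx IHy].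
  by rewrite tassoc_pureE tmap_pure.
by rewrite !(linearDl, linearD) IHx IHy.
Qed.

(** (id ⊗ F) o D factors through F by colinearity, so D x lies in the kernel of
    id ⊗ F, which is H ⊗ L' by exactness. *)
Lemma induced_coact_stable (x : L') :
  exists y : H ⊗ L', tmap idfun incl y = cofree_coact Delta L (incl x).
Proof.
pose F : {linear H ⊗ L -> (H ⊗ B) ⊗ L} :=
  tmap coactR idfun \- tmap tensor1 idfun.
apply: (@tmap_idl_exact _ _ _ _ _ incl F incl_inj) => [y /eqP|].
  rewrite subr_eq0 => /eqP/induced_predP yP.
  by exists (InducedSpace yP).
rewrite tmap_idl_sub (cofree_coact_tmap coactR_colinear).
by rewrite (cofree_coact_tmap tensor1_colinear) induced_coinvariant subrr.
Qed.

Lemma induced_action_exists :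
  exists2 alpha : {linear H ⊗ L' -> L'}, is_induced_action alpha &
    is_left_module alpha.
Proof.
pose act : {linear H ⊗ (H ⊗ L) -> H ⊗ L} := right_act H (eta \o tmap pi idfun).
have actE h x : act (h ⊗ₜ x) = tmap idfun (actB eta (pi h)) x.
  rewrite /act right_act_pure; apply: eq_tmap => // l.
  by rewrite /= tmap_pure.
have [|alpha alphaE] :=
    @linear_corestrict _ _ _ _ incl (act \o tmap idfun incl) incl_inj.
  elim/tensor_ind => [h x|x y [u uE] [v vE]].
    have [y yE] := induced_act_stable h x; exists y.
    by rewrite /= tmap_pure actE.
  by exists (u + v); rewrite !linearD uE vE.
have alpha_act h x : incl (alpha (h ⊗ₜ x)) = act (h ⊗ₜ incl x).
  by rewrite alphaE /= tmap_pure.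
exists alpha => [h x|]; first by rewrite alpha_act actE.
apply: submodule_act incl_inj alpha_act _.
exact/right_act_module/pullback_act.
Qed.

Lemma induced_coaction_exists :
  exists2 beta : {linear L' -> H ⊗ L'}, is_induced_coaction beta &
    is_left_comodule Delta eps beta.
Proof.
have [beta betaE] := @linear_corestrict _ _ _ _ _ (cofree_coact Delta L \o incl)
  (tmap_idl_inj incl_inj) induced_coact_stable.
exists beta => //.
exact: subcomodule_coact incl_inj betaE (cofree_comodule L bialgH).
Qed.

Lemma induced_phiP (alpha : {linear H ⊗ L' -> L'}) :
  is_induced_action alpha -> is_induced_phi (right_act H alpha).
Proof.
move=> alphaE h h' x; rewrite right_act_pure !tmap_pure.
by congr (_ ⊗ₜ _); apply: alphaE.
Qed.

(** By naturality of D in its second factor: it commutes with id ⊗ eta_(pi h),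
    and phi_H acts as id ⊗ (id ⊗ eta_(pi h)) on H ⊗ (H ⊗ L). *)
Lemma induced_compat (alpha : {linear H ⊗ L' -> L'})
    (beta : {linear L' -> H ⊗ L'}) :
  is_induced_action alpha -> is_induced_coaction beta ->
  forall x, beta (alpha x) = right_act H alpha (tmap idfun beta x).
Proof.
move=> alphaE betaE; elim/tensor_ind => [h x|x y IHx IHy]; last first.
  by rewrite !linearD IHx IHy.
apply: (tmap_idl_inj incl_inj).
rewrite tmap_pure right_act_pure betaE alphaE.
rewrite -[LHS]/(cofree_coact Delta L (tmap idfun (actB eta (pi h)) (incl x))).
rewrite cofree_coact_natural /= -betaE.
rewrite (@tmap_idl_tmap _ _ _ _ _ _ _ (incl \o actB alpha h)).
  by apply/esym; apply: tmap_idl_tmap.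
by move=> y; apply/esym/alphaE.
Qed.

End Induced.

Theorem theorem2p12 (R : realType) (K : numFieldType)
    (KRC : real_or_complex R K)
    (H : algType K) (Delta : {linear H -> H ⊗ H}) (eps : {linear H -> K^o})
    (S : {linear H -> H}) (hopfH : is_hopf_algebra Delta eps S)
    (B : algType K) (DeltaB : {linear B -> B ⊗ B}) (epsB : {linear B -> K^o})
    (pi : {lrmorphism H -> B})
    (subB : is_quantum_subgroup Delta eps DeltaB epsB pi)
    (L : completeNormedModType K) (ip : {dot L for scalar_conj KRC})
    (ip_norm : forall l : L, `|l| ^+ 2 = ip l l)
    (eta : {linear B ⊗ L -> L}) (modL : is_left_module eta) :
  let L' := induced_space Delta pi eta in
  exists (alpha : {linear H ⊗ L' -> L'}) (beta : {linear L' -> H ⊗ L'})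
         (phiH : {linear H ⊗ (H ⊗ L') -> H ⊗ L'}),
    [/\ is_induced_action alpha, is_induced_coaction beta, is_induced_phi phiH
      & is_left_hopf_rep1 Delta eps alpha beta phiH].
Proof.
have bialgH := hopf_bialgebra hopfH.
have [alpha alphaE alpha_module] := induced_action_exists Delta pi modL.
have [beta betaE beta_comodule] := induced_coaction_exists pi bialgH modL.
exists alpha, beta, (right_act H alpha); split=> //.
  exact: induced_phiP.
by split=> //; [apply: right_act_module|apply: induced_compat].
Qed.
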